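(* Let $(\gamma,\nu):I\to\mathbb{R}^2\times S^1$ be a Legendre curve with curvature $(\ell,\beta)$. Suppose that there exists a smooth map $(k_1,k_2):I\to\mathbb{R}^2\setminus\{0\}$ such that $k_1(t)\ell(t)+k_2(t)\beta(t)=0$ for all $t\in I$. If there exist four points of $I$ each of which is a point of $\gamma$ of some type $(n,m)$, $m=n+k$, satisfying one of (i) $n=k$ and $\dot f(0)=0$ (where $f$ is the function germ in the normal form at that point), (ii) $n\ge k+2$, (iii) $n+2\le k$, then $\gamma$ has at least four vertices.
   Context: All maps are $C^\infty$; $I$ is a closed interval. $\mathbb{R}^2$ has the standard inner product, $S^1\subset\mathbb{R}^2$ is the unit circle, and $J(x,y)=(-y,x)$. A smooth map $(\gamma,\nu):I\to\mathbb{R}^2\times S^1$ is a Legendre curve if $\dot\gamma(t)\cdot\nu(t)=0$ for all $t\in I$; then $\gamma$ is called a frontal. Put $\mu=J(\nu)$. The curvature $(\ell,\beta)$ is $\ell=\dot\nu\cdot\mu$, $\beta=\dot\gamma\cdot\mu$, so that $\dot\nu=\ell\mu$, $\dot\mu=-\ell\nu$, $\dot\gamma=\beta\mu$. Vertex (general case): given the pair $(k_1,k_2)$ of the hypothesis, $t_0\in I$ is a vertex of $\gamma$ if $\dot k_1(t_0)k_2(t_0)-k_1(t_0)\dot k_2(t_0)=0$. Type $(n,m)$: with $n,k$ positive integers and $m=n+k$, $\gamma$ has a point $t_0$ of type $(n,m)$ if, after translating $\gamma(t_0)$ to the origin, the germ of $(\gamma,\nu)$ at $t_0$ is $\mathcal{R}$-equivalent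 to (i.e. equal, after composition with a diffeomorphism germ of the source taking $t_0$ to $0$, to) a germ $(\widetilde\gamma,\widetilde\nu):(\mathbb{R},0)\to\mathbb{R}^2\times S^1$ of the form $$\widetilde\gamma(t)=(\pm t^n,t^mf(t)),\qquad \widetilde\nu(t)=\frac{(-mt^kf(t)-t^{k+1}\dot f(t),\,\pm n)}{\sqrt{(mt^kf(t)+t^{k+1}\dot f(t))^2+n^2}},$$ with the same sign in both places, where $f:(\mathbb{R},0)\to\mathbb{R}$ is a smooth function germ with $f(0)\ne0$. *)

(* Defs.v *)
From mathcomp Require Import all_boot all_order all_algebra.
From mathcomp Require Import all_classical all_reals all_analysis.

Set Implicit Arguments.
Unset Strict Implicit.
Unset Printing Implicit Defensive.

Import Order.TTheory GRing.Theory Num.Theory numFieldNormedType.Exports.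
Local Open Scope classical_set_scope.
Local Open Scope ring_scope.

(* Maps on an interval I are represented by total functions on R; every notion
   below whose argument is I depends only on the values taken on I.            *)

Section CalculusOnASet.
Context {R : realType}.
Implicit Types (I : set R) (g : R -> R) (c : R -> R * R) (t : R).

Definition diff_quotient g t (s : R) : R := (s - t)^-1 * (g s - g t).

(* The limit is taken along s in I, s <> t: this is the one-sided derivative at
   an endpoint of I, and the usual derivative at an interior point.            *)
Definition derivable_in I g t : Prop :=
  cvg (diff_quotient g t s @[s --> within I t^']).

Definition derive_in I g t : R :=
  lim (diff_quotient g t s @[s --> within I t^']).

Definition smooth_in I g : Prop :=
  forall (n : nat) t, I t -> derivable_in I (iter n (derive_in I) g) t.

Definition smooth_curve_in I c : Prop :=
  smooth_in I (fun t => (c t).1) /\ smooth_in I (fun t => (c t).2).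

Definition velocity_in I c t : R * R :=
  (derive_in I (fun s => (c s).1) t, derive_in I (fun s => (c s).2) t).

End CalculusOnASet.

Section PlaneCurves.
Context {R : realType}.
Implicit Types (I : set R) (gamma nu : R -> R * R) (t : R).

Definition dot (u v : R * R) : R := u.1 * v.1 + u.2 * v.2.

Definition J (u : R * R) : R * R := (- u.2, u.1).

Definition legendre_curve I gamma nu : Prop :=
  [/\ smooth_curve_in I gamma, smooth_curve_in I nu,
      (forall t, I t -> dot (nu t) (nu t) = 1)
    & (forall t, I t -> dot (velocity_in I gamma t) (nu t) = 0)].

Definition curvature_ell I nu t : R :=
  dot (velocity_in I nu t) (J (nu t)).

Definition curvature_beta I gamma nu t : R :=
  dot (velocity_in I gamma t) (J (nu t)).

Definition vertex I (k1 k2 : R -> R) t : Prop :=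
  I t /\ derive_in I k1 t * k2 t - k1 t * derive_in I k2 t = 0.

End PlaneCurves.

Section NormalForm.
Context {R : realType}.

Definition smooth_germ (f : R -> R) (x : R) : Prop :=
  \forall y \near x, forall n : nat, derivable (derive1n n f) y 1.

Definition diffeo_germ (phi : R -> R) (x y : R) : Prop :=
  [/\ phi x = y, smooth_germ phi x
    & exists psi : R -> R,
      [/\ psi y = x, smooth_germ psi y,
          (\forall s \near x, psi (phi s) = s)
        & (\forall s \near y, phi (psi s) = s)]].

(* In the next three definitions m = n + k, and the sign is (-1) ^+ e. *)

Definition normal_gamma (e : bool) (n k : nat) (f : R -> R) (t : R) : R * R :=
  ((-1) ^+ e * t ^+ n, t ^+ (n + k) * f t).

Definition normal_nu (e : bool) (n k : nat) (f : R -> R) (t : R) : R * R :=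
  let w := (n + k)%:R * t ^+ k * f t + t ^+ k.+1 * derive1 f t in
  let N := Num.sqrt (w ^+ 2 + n%:R ^+ 2) in
  (- w / N, (-1) ^+ e * n%:R / N).

(* t0 is a point of type (n, n + k) with germ f in the normal form. At an
   endpoint t0 of I the germ at t0 is the one along I, phi and f being smooth
   on two-sided neighbourhoods.                                                *)
Definition point_of_type (I : set R) (gamma nu : R -> R * R) (t0 : R)
    (n k : nat) (f : R -> R) : Prop :=
  [/\ I t0, (0 < n)%N, (0 < k)%N, smooth_germ f 0 /\ f 0 != 0
    & exists (e : bool) (phi : R -> R),
      diffeo_germ phi t0 0 /\
      \forall t \near within I (nbhs t0),
        gamma t - gamma t0 = normal_gamma e n k f (phi t) /\
        nu t = normal_nu e n k f (phi t)].

End NormalForm.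

Definition at_least (N : nat) (T : Type) (P : T -> Prop) : Prop :=
  exists x : 'I_N -> T, injective x /\ forall i, P (x i).

(* Main.v *)
Require Import Defs.
From mathcomp Require Import all_boot all_order all_algebra.
From mathcomp Require Import all_classical all_reals all_analysis.
From mathcomp Require Import ring lra zify.

Set Implicit Arguments.
Unset Strict Implicit.
Unset Printing Implicit Defensive.

Import Order.TTheory GRing.Theory Num.Theory numFieldNormedType.Exports.
Local Open Scope classical_set_scope.
Local Open Scope ring_scope.

(* Each of the given points is itself a vertex. In the normal form with source
   parameter u one finds ell = D u^(k-1) and beta = E u^(n-1), up to the common
   factor u'(t), with D and E nonvanishing near 0. So k1 ell + k2 beta = 0
   gives, after cancelling powers of u and passing to the limit,
   k1 = k2 u^(n-k) q if k <= n, and k2 = k1 u^(k-n) / q if n <= k, where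
   q = - E / D. The factor u^(n-k) q, resp. u^(k-n) / q, is stationary at 0: if
   |n - k| >= 2 because of the power of u, and if n = k because q'(0) is a
   multiple of f'(0). A stationary factor makes k1' k2 - k1 k2' vanish. *)

(** * Derivatives along a subset of the line *)

Section DerivativeAlongASet.
Context {R : realType} {I : set R} {t : R}.
Implicit Types g h : R -> R.

(** A relation rather than a value: it carries convergence along with the limit, so derivatives can
    be combined before uniqueness is available. *)
Definition has_derivative_in (J : set R) g x (d : R) : Prop :=
  diff_quotient g x s @[s --> within J x^'] --> d.

Lemma near_within_dnbhs (P : set R) :
  (\forall s \near within I (nbhs t), P s) ->
  \forall s \near within I t^', P s.
Proof.
move=> H; suff : nbhs t (fun s => s != t -> I s -> P s) by [].
have : nbhs t (fun s => I s -> P s) := H.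
by apply: filterS => s + _.
Qed.

Lemma near_dnbhs_neq : \forall s \near within I t^', s != t.
Proof.
suff : nbhs t (fun s => s != t -> I s -> s != t) by [].
by apply: filterE => s.
Qed.

Lemma has_derivative_inP g : derivable_in I g t ->
  has_derivative_in I g t (derive_in I g t).
Proof. by []. Qed.

(** By Caratheodory's criterion, the difference quotient agrees off [t] with a function [q] that is
    continuous at [t]. *)
Lemma is_derive_has_derivative_in g d :
  is_derive t 1 g d -> has_derivative_in I g t d.
Proof.
move=> /is_derive1_caratheodory [q [gq qc <-]].
have qt : q s @[s --> within I t^'] --> q t.
  by move=> P /qc Pq; apply: near_within_dnbhs; exact: cvg_within.
apply: cvg_trans qt; apply: near_eq_cvg.
near=> s.
have st : s - t != 0 by rewrite subr_eq0; near: s; exact: near_dnbhs_neq.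
by rewrite /diff_quotient gq mulrCA mulVf ?mulr1.
Unshelve. all: by end_near. Qed.

Lemma has_derivative_in_continuous g d :
  has_derivative_in I g t d -> g s @[s --> within I t^'] --> g t.
Proof.
move=> gd.
have tt : s @[s --> within I t^'] --> t.
  by move=> P Pt; apply: near_within_dnbhs; exact: cvg_within.
have : diff_quotient g t s * (s - t) + g t @[s --> within I t^'] --> g t.
  rewrite -[X in _ --> X]add0r -[X in X + _](mulr0 d) -(subrr t).
  by apply: cvgD (cvg_cst _); apply: cvgM => //; apply: cvgB (cvg_cst _).
apply: cvg_trans; apply: near_eq_cvg; near=> s.
have st : s - t != 0 by rewrite subr_eq0; near: s; exact: near_dnbhs_neq.
by rewrite /diff_quotient mulrAC mulVf// mul1r subrK.
Unshelve. all: by end_near. Qed.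

Lemma has_derivative_inM g h a b :
  has_derivative_in I g t a -> has_derivative_in I h t b ->
  has_derivative_in I (fun s => g s * h s) t (a * h t + g t * b).
Proof.
(* The Leibniz splitting of the quotient has the moving factor [h s], hence the continuity of [h] at
   [t]. *)
move=> ga hb; have hc := has_derivative_in_continuous hb.
have : diff_quotient g t s * h s + g t * diff_quotient h t s
    @[s --> within I t^'] --> a * h t + g t * b.
  by apply: cvgD; apply: cvgM => //; exact: cvg_cst.
apply: cvg_trans; apply: near_eq_cvg; near=> s.
by rewrite /diff_quotient; ring.
Unshelve. all: by end_near. Qed.

Lemma has_derivative_in_near_eq g h d : g t = h t ->
  (\forall s \near within I t^', g s = h s) ->
  has_derivative_in I g t d -> has_derivative_in I h t d.
Proof.
move=> ght gh; apply: cvg_trans; apply: near_eq_cvg; near=> s.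
by rewrite /diff_quotient ght; congr (_ * (_ - _)); near: s.
Unshelve. all: by end_near. Qed.

Context {PI : ProperFilter (within I t^')}.

(** Properness of the filter says that [t] is an accumulation point of [I]; at an isolated point
    every number would be a derivative. *)
Lemma has_derivative_in_unique g a b :
  has_derivative_in I g t a -> has_derivative_in I g t b -> a = b.
Proof. exact: (cvg_unique (@norm_hausdorff R R)). Qed.

(** At an endpoint [g] follows the formula [h] on one side only, whereas [h] has an ordinary
    derivative, computable by the usual rules. *)
Lemma derive_in_near_eq g h d : I t ->
  (\forall s \near within I (nbhs t), g s = h s) -> is_derive t 1 h d ->
  derive_in I g t = d.
Proof.
move=> It gh /is_derive_has_derivative_in hd.
have ght : g t = h t by move: gh; rewrite near_withinE => /nbhs_singleton; exact.
apply: (cvg_lim (@norm_hausdorff R R)).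
apply: has_derivative_in_near_eq hd; first by rewrite ght.
by apply: near_within_dnbhs; move: gh; apply: filterS => s ->.
Qed.

(** By continuity k1 = k2 q holds at [t] too. Since q' = 0 there, k1' = k2' q, and both products
    equal k2 k2' q. *)
Lemma wronskian_eq0 (k1 k2 q : R -> R) :
  derivable_in I k1 t -> derivable_in I k2 t -> is_derive t 1 q 0 ->
  (\forall s \near within I t^', k1 s = k2 s * q s) ->
  derive_in I k1 t * k2 t - k1 t * derive_in I k2 t = 0.
Proof.
move=> /has_derivative_inP dk1 /has_derivative_inP dk2.
move=> /is_derive_has_derivative_in dq k1E.
have dkq := has_derivative_inM dk2 dq.
have k1tE : k1 t = k2 t * q t.
  apply: (cvg_unique (@norm_hausdorff R R)) (has_derivative_in_continuous dkq).
  apply: cvg_trans (has_derivative_in_continuous dk1).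
  by apply: near_eq_cvg; move: k1E; apply: filterS => s ->.
have -> := has_derivative_in_unique (has_derivative_in_near_eq k1tE k1E dk1) dkq.
by rewrite k1tE; ring.
Qed.

End DerivativeAlongASet.

Lemma interval_within_dnbhs_proper (R : realType) (I : set R) (x y t : R) :
  is_interval I -> I x -> I y -> x != y -> I t -> ProperFilter (within I t^').
Proof.
move=> iI Ix Iy xy It.
have [z Iz zt] : exists2 z, I z & z != t.
  by have [xt|] := eqVneq x t; [exists y; rewrite // -xt eq_sym|exists x].
apply: Build_ProperFilter; rewrite /within /= /dnbhs.
move=> /nbhs_ballP[e /= e0 eP].
have [ltzt|ltzt|eqzt] := ltgtP z t; last by rewrite eqzt eqxx in zt.
(* Whichever of [z] and [t - e / 2] is closer to [t] lies both in [I] and in the ball of radius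
   [e]. *)
- set s := Num.max z (t - e / 2).
  have st : s < t by rewrite /s gt_max ltzt/=; lra.
  have zs : z <= s by rewrite /s le_max lexx.
  have es : t - e / 2 <= s by rewrite /s le_max lexx orbT.
  apply: (eP s); last 2 first.
  + by rewrite /= lt_eqF.
  + by apply: (iI z t) => //; rewrite zs ltW.
  + by rewrite /ball /= ger0_norm; lra.
- set s := Num.min z (t + e / 2).
  have st : t < s by rewrite /s lt_min ltzt/=; lra.
  have zs : s <= z by rewrite /s ge_min lexx.
  have es : s <= t + e / 2 by rewrite /s ge_min lexx orbT.
  apply: (eP s); last 2 first.
  + by rewrite /= gt_eqF.
  + by apply: (iI t z) => //; rewrite zs ltW.
  + by rewrite /ball /= ler0_norm; lra.
Qed.

(** * Calculus of the normal form *)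

Section NormalFormCalculus.
Context {R : realType}.
Implicit Types (f g : R -> R) (n k : nat) (x u : R).

Lemma is_derive1X f n x d : is_derive x 1 f d ->
  is_derive x 1 (fun y => f y ^+ n) (n%:R * f x ^+ n.-1 * d).
Proof.
move=> fd; have := is_deriveX n fd.
suff -> : f ^+ n = (fun y => f y ^+ n) by [].
by apply/funext => y; rewrite exprfctE.
Qed.

(* The velocity of the normal form is u^(n-1) (+-n, slope u); its length is
   |u|^(n-1) speed u, and the derivative of slope is u^(k-1) slope_deriv u. *)
Definition slope n k f u : R :=
  (n + k)%:R * u ^+ k * f u + u ^+ k.+1 * derive1 f u.

Definition slope_deriv n k f u : R :=
  ((n + k) * k)%:R * f u + (n + k + k.+1)%:R * (u * derive1 f u)
  + u ^+ 2 * derive1 (derive1 f) u.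

Definition speed n k f u : R := Num.sqrt (slope n k f u ^+ 2 + n%:R ^+ 2).

Lemma speed_arg_gt0 n k f u : (0 < n)%N ->
  0 < slope n k f u ^+ 2 + n%:R ^+ 2 :> R.
Proof. by move=> n0; rewrite ltr_wpDl ?sqr_ge0// exprn_gt0// ltr0n. Qed.

Lemma speed_gt0 n k f u : (0 < n)%N -> 0 < speed n k f u.
Proof. by move=> n0; rewrite sqrtr_gt0 speed_arg_gt0. Qed.

Lemma is_derive_derive1 f x : derivable f x 1 -> is_derive x 1 f (derive1 f x).
Proof. by move=> /derivableP; rewrite -derive1E. Qed.

Lemma is_derive_slope n k f u : (0 < k)%N ->
  derivable f u 1 -> derivable (derive1 f) u 1 ->
  is_derive u 1 (slope n k f) (u ^+ k.-1 * slope_deriv n k f u).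
Proof.
move=> k0 /is_derive_derive1 df /is_derive_derive1 ddf.
have dk := is_derive1X k (is_derive_id u 1).
have dk1 := is_derive1X k.+1 (is_derive_id u 1).
apply: is_derive_eq; rewrite /= /slope_deriv.
case: k k0 dk dk1 => // k _ dk dk1.
rewrite /GRing.scale /=. rewrite !exprS !natrD; ring.
Qed.

Lemma is_derive_speed n k f u d : (0 < n)%N -> is_derive u 1 (slope n k f) d ->
  is_derive u 1 (speed n k f) (slope n k f u * d / speed n k f u).
Proof.
move=> n0 dw; have N0 := speed_gt0 k f u n0.
have dsq : is_derive u 1 (fun y => slope n k f y ^+ 2 + n%:R ^+ 2)
    (2%:R * slope n k f u * d).
  by apply: is_derive_eq; rewrite /GRing.scale /=; ring.
have dsqrt := is_derive1_sqrt (speed_arg_gt0 k f u n0).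
pose g y := slope n k f y ^+ 2 + n%:R ^+ 2.
apply: (is_derive_eq (@is_derive1_comp _ _ g _ _ _ dsqrt dsq)).
by rewrite -/(speed n k f u); field; rewrite gt_eqF.
Qed.

Lemma is_derive_continuous f x d : is_derive x 1 f d -> {for x, continuous f}.
Proof.
by move=> [+ _] => /derivable1_diffP; exact: differentiable_continuous.
Qed.

Lemma slope0 n k f : (0 < k)%N -> slope n k f 0 = 0.
Proof. by move=> k0; rewrite /slope !expr0n -(prednK k0) !mulr0 !mul0r addr0. Qed.

Lemma slope_deriv0 n k f : slope_deriv n k f 0 = ((n + k) * k)%:R * f 0.
Proof. by rewrite /slope_deriv expr0n !mul0r !mulr0 !addr0. Qed.

Lemma signed_slope_deriv0_neq0 (e : bool) n k f : (0 < n)%N -> (0 < k)%N ->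
  f 0 != 0 -> (-1) ^+ e * n%:R * slope_deriv n k f 0 != 0 :> R.
Proof.
move=> n0 k0 f0; rewrite slope_deriv0.
rewrite !mulf_neq0 ?signr_eq0 ?pnatr_eq0 -?lt0n//.
by rewrite muln_gt0 addn_gt0 n0.
Qed.

(* - beta / ell = u^(n-k) curvature_ratio u *)
Definition curvature_ratio (e : bool) n k f u : R :=
  speed n k f u ^+ 3 / ((-1) ^+ e * n%:R * slope_deriv n k f u).

(** The slope vanishes at 0, so the speed is stationary there and only the denominator contributes,
    through a multiple of f'(0). *)
Lemma is_derive_curvature_ratio (e : bool) n k f : (0 < n)%N -> (0 < k)%N ->
  f 0 != 0 -> derivable f 0 1 -> derivable (derive1 f) 0 1 ->
  derivable (derive1 (derive1 f)) 0 1 ->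
  exists c : R,
    is_derive (0 : R) 1 (curvature_ratio e n k f) (c * derive1 f 0).
Proof.
move=> n0 k0 f0 df ddf dddf.
have dN := is_derive_speed n0 (is_derive_slope n k0 df ddf).
rewrite slope0 // !mul0r in dN.
move: df ddf dddf => /is_derive_derive1 df /is_derive_derive1 ddf.
move=> /is_derive_derive1 dddf.
set D := (-1) ^+ e * n%:R * slope_deriv n k f 0 : R.
have D0 : D != 0 := signed_slope_deriv0_neq0 e n0 k0 f0.
(* The first two terms of [slope_deriv] contribute these coefficients of f'(0); the term in u^2
   contributes nothing at 0. *)
set c := ((n + k) * k)%:R + (n + k + k.+1)%:R : R.
have dD : is_derive (0 : R) 1 (fun u => (-1) ^+ e * n%:R * slope_deriv n k f u)
    ((-1) ^+ e * n%:R * (c * derive1 f 0)).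
  apply: is_derive_eq; rewrite /GRing.scale /= /c.
  by rewrite !(mul0r, mulr0, addr0, add0r, mulr1); ring.
pose den u := (-1) ^+ e * n%:R * slope_deriv n k f u.
have dV := @is_deriveV _ den _ _ _ D0 dD.
exists (speed n k f 0 ^+ 3 * (- D ^- 2 * ((-1) ^+ e * n%:R * c))).
apply: is_derive_eq; rewrite /GRing.scale /=.
by rewrite -/D; ring.
Qed.

(** * Curvature in terms of the source diffeomorphism *)

Lemma curvature_normal_form (I : set R) (gamma nu : R -> R * R) c t p e n k f
    (phi : R -> R) :
  ProperFilter (within I t^') -> I t -> (0 < n)%N -> (0 < k)%N ->
  is_derive t 1 phi p -> derivable f (phi t) 1 -> derivable (derive1 f) (phi t) 1 ->
  (\forall s \near within I (nbhs t),
     gamma s - c = normal_gamma e n k f (phi s) /\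
     nu s = normal_nu e n k f (phi s)) ->
  curvature_ell I nu t = p * ((-1) ^+ e * n%:R *
    (phi t ^+ k.-1 * slope_deriv n k f (phi t)) / speed n k f (phi t) ^+ 2) /\
  curvature_beta I gamma nu t = - (p * phi t ^+ n.-1 * speed n k f (phi t)).
Proof.
move=> PI It n0 k0 dphi df ddf nf.
have [_ nut] : gamma t - c = normal_gamma e n k f (phi t) /\
    nu t = normal_nu e n k f (phi t).
  by move: nf; rewrite near_withinE => /nbhs_singleton; exact.
have dw := is_derive_slope n k0 df ddf.
have dN := is_derive_speed n0 dw.
have N0 : speed n k f (phi t) != 0 by rewrite gt_eqF ?speed_gt0.
have N2 : speed n k f (phi t) ^+ 2 = slope n k f (phi t) ^+ 2 + n%:R ^+ 2.
  by rewrite sqr_sqrtr// ltW// speed_arg_gt0.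
have dw' := is_derive1_comp dw dphi.
(* The derivative [W] of the normalising factor [V] may stay unknown: it multiplies a vector
   parallel to [nu], which is orthogonal to [J (nu t)], so it drops out of ell. *)
pose V s := (speed n k f (phi s))^-1.
have [W dV] : exists W, is_derive t 1 V W.
  by eexists; exact: is_derive1_comp (is_deriveV N0 dN) dphi.
have VE s : V s = (speed n k f (phi s))^-1 by [].
clearbody V.
have df' := is_derive1_comp (is_derive_derive1 df) dphi.
have nu1 : derive_in I (fun s => (nu s).1) t =
    - (phi t ^+ k.-1 * slope_deriv n k f (phi t) * p / speed n k f (phi t)
       + slope n k f (phi t) * W).
  apply: (@derive_in_near_eq _ _ _ _ _
    (fun s => - ((slope n k f \o phi) s * V s))) => //.
    by move: nf; apply: filterS => s [_ ->]; rewrite VE; exact: mulNr.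
  by apply: is_derive_eq; rewrite /GRing.scale /= VE; ring.
have nu2 : derive_in I (fun s => (nu s).2) t = (-1) ^+ e * n%:R * W.
  apply: (@derive_in_near_eq _ _ _ _ _
    (fun s => (-1) ^+ e * n%:R * V s)) => //.
    by move: nf; apply: filterS => s [_ ->]; rewrite VE.
have gamma1 : derive_in I (fun s => (gamma s).1) t =
    (-1) ^+ e * n%:R * phi t ^+ n.-1 * p.
  apply: (@derive_in_near_eq _ _ _ _ _
    (fun s => c.1 + (-1) ^+ e * phi s ^+ n)) => //.
    move: nf; apply: filterS => s [+ _] => /(congr1 fst) /= <-.
    by rewrite addrC subrK.
  have dphin := is_derive1X n dphi.
  by apply: is_derive_eq; rewrite /GRing.scale /=; ring.
have gamma2 : derive_in I (fun s => (gamma s).2) t =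
    phi t ^+ n.-1 * slope n k f (phi t) * p.
  apply: (@derive_in_near_eq _ _ _ _ _
    (fun s => c.2 + phi s ^+ (n + k) * (f \o phi) s)) => //.
    move: nf; apply: filterS => s [+ _] => /(congr1 snd) /= <-.
    by rewrite addrC subrK.
  have dphin := is_derive1X (n + k) dphi.
  apply: is_derive_eq; rewrite /GRing.scale /= /slope.
  by rewrite -(prednK n0) addSn /= !exprS !exprD; ring.
have sign2 : (-1) ^+ e * (-1) ^+ e = 1 :> R by rewrite -signr_addb addbb.
rewrite /curvature_ell /curvature_beta /dot /velocity_in nu1 nu2 gamma1 gamma2.
rewrite nut /J /normal_nu /= -/(slope n k f (phi t)) -/(speed n k f (phi t)).
split; first by field.
have -> : - (p * phi t ^+ n.-1 * speed n k f (phi t)) =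
    - (p * phi t ^+ n.-1 * speed n k f (phi t) ^+ 2 / speed n k f (phi t)).
  by field.
(* The square of the sign is inserted by hand, since [field] treats [(-1) ^+ e] as an atom. *)
have n2 : n%:R ^+ 2 = (-1) ^+ e * (-1) ^+ e * n%:R ^+ 2 :> R.
  by rewrite sign2 mul1r.
by rewrite N2 n2; field.
Qed.

(** Differentiating [psi (phi s) = s] gives psi' phi' = 1, so phi' is nonzero; and [phi t = 0]
    forces [t = psi 0 = t0]. *)
Lemma diffeo_germ_near (phi : R -> R) t0 : diffeo_germ phi t0 0 ->
  \forall t \near t0, exists p : R,
    [/\ is_derive (t : R) 1 phi p, p != 0 & t != t0 -> phi t != 0].
Proof.
move=> [phit0 sphi [psi [psi0 spsi psiK _]]].
have dphi : \forall t \near t0, derivable phi t 1.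
  by move: sphi; apply: filterS => t /(_ 0).
have phic : {for t0, continuous phi}.
  exact: is_derive_continuous (is_derive_derive1 (nbhs_singleton dphi)).
have dpsi0 : nbhs (phi t0) (fun u => derivable psi u 1).
  by rewrite phit0; move: spsi; apply: filterS => u /(_ 0).
have dpsi : \forall t \near t0, derivable psi (phi t) 1 by exact: phic dpsi0.
near=> t.
have /is_derive_derive1 dt : derivable phi t 1 by near: t.
have /is_derive_derive1 ds : derivable psi (phi t) 1 by near: t.
(* To be differentiated at [t], the identity must hold on a neighbourhood of [t]. *)
have psiKt : \forall s \near t, psi (phi s) = s.
  by near: t; exact: (near_join psiK).
have := near_eq_is_derive _ (is_derive1_comp ds dt).
move=> /(_ id psiKt) [_]; rewrite (derive_val (is_derive := is_derive_id t 1)).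
move=> pq; exists (derive1 phi t); split => //.
- by apply/eqP => p0; move/eqP: pq; rewrite p0 mulr0 oner_eq0.
- apply: contraNneq => phit; apply/eqP.
  by rewrite -(nbhs_singleton psiKt) phit.
Unshelve. all: by end_near. Qed.

(** The exponent 1 is left out: there the derivative would be [q 0]. *)
Lemma is_derive0_powM (q : R -> R) a d :
  is_derive (0 : R) 1 q d -> (a = 0 /\ d = 0) \/ (2 <= a)%N ->
  is_derive (0 : R) 1 (fun u => u ^+ a * q u) 0.
Proof.
move=> dq ad; have da := is_derive1X a (is_derive_id (0 : R) 1).
apply: is_derive_eq; rewrite /GRing.scale /=.
case: ad => [[-> ->]|]; first by rewrite !(mul0r, mulr0, addr0).
by case: a da => [|[|a]] // _ _; rewrite !exprS !(mul0r, mulr0, addr0).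
Qed.

End NormalFormCalculus.

(** * Each point of an admissible type is a vertex *)

Lemma point_of_type_vertex (R : realType) (I : set R) (gamma nu : R -> R * R)
    (k1 k2 : R -> R) (t0 : R) (n k : nat) (f : R -> R) :
  (forall t, I t -> ProperFilter (within I t^')) ->
  derivable_in I k1 t0 -> derivable_in I k2 t0 ->
  (forall t, I t ->
     k1 t * curvature_ell I nu t + k2 t * curvature_beta I gamma nu t = 0) ->
  point_of_type I gamma nu t0 n k f ->
  [\/ n = k /\ derive1 f 0 = 0, (k + 2 <= n)%N | (n + 2 <= k)%N] ->
  vertex I k1 k2 t0.
Proof.
move=> PI dk1 dk2 kcurv [It0 n0 k0 [sf f0] [e [phi [dphi nf]]]] nk; split=> //.
have phit0 : phi t0 = 0 by case: dphi.
have sf0 := nbhs_singleton sf.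
have [p0 [dphi0 _ _]] := nbhs_singleton (diffeo_germ_near dphi).
have phic := is_derive_continuous dphi0.
have [c dq] := is_derive_curvature_ratio e n0 k0 f0 (sf0 0) (sf0 1) (sf0 2).
set q := curvature_ratio e n k f in dq.
have sd0 := signed_slope_deriv0_neq0 e n0 k0 f0.
have q0 : q 0 != 0.
  by rewrite mulf_neq0 ?invr_eq0// expf_neq0// gt_eqF// speed_gt0.
have dqV := is_deriveV q0 dq.
have q_neq0 : \forall t \near t0, q (phi t) != 0.
  have dq' := dq; rewrite -[X in is_derive X]phit0 in dq'.
  have := is_derive_continuous (is_derive1_comp dq' dphi0).
  by move/cvgr_neq0; apply; rewrite /= phit0.
have phi_nbhs (P : set R) : nbhs 0 P -> \forall t \near t0, P (phi t).
  by rewrite -phit0 => /phic.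
(* Powers of [phi t] are kept on both sides, so that one relation serves [k <= n] and [n <= k]
   alike. *)
have near_t : \forall t \near within I t0^', phi t != 0 /\
    k1 t * phi t ^+ k.-1 = k2 t * phi t ^+ n.-1 * q (phi t).
  suff : \forall t \near t0, t != t0 -> I t -> phi t != 0 /\
      k1 t * phi t ^+ k.-1 = k2 t * phi t ^+ n.-1 * q (phi t) by [].
  (* The curvature at [t] involves derivatives, so the normal form is needed around each [t] close
     to [t0]. *)
  have nf_join := near_join nf.
  near=> t => tt0 It.
  have [p [dphit p_neq0 /(_ tt0) phit_neq0]] : exists p : R,
      [/\ is_derive t 1 phi p, p != 0 & t != t0 -> phi t != 0].
    by near: t; exact: diffeo_germ_near.
  split=> //.
  have sft : forall i, derivable (derive1n i f) (phi t) 1.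
    by near: t; exact: (phi_nbhs _ sf).
  have nft : \forall s \near within I (nbhs t),
     gamma s - gamma t0 = normal_gamma e n k f (phi s) /\
     nu s = normal_nu e n k f (phi s) by near: t.
  have [ellE betaE] :=
    curvature_normal_form (PI _ It) It n0 k0 dphit (sft 0) (sft 1) nft.
  (* As [0^-1 = 0], a nonzero quotient has a nonzero denominator, hence [slope_deriv] is nonzero at
     [phi t]. *)
  have : q (phi t) != 0 by near: t.
  rewrite mulf_eq0 negb_or invr_eq0 => /andP[_].
  rewrite mulf_eq0 negb_or => /andP[sn sd].
  have N0 : speed n k f (phi t) != 0 by rewrite gt_eqF ?speed_gt0.
  have /eqP := kcurv _ It; rewrite ellE betaE addr_eq0 mulrN opprK => /eqP kE.
  set D := (-1) ^+ e * n%:R in sn kE *.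
  set sl := slope_deriv _ _ _ _ in sd kE *; set N := speed _ _ _ _ in N0 kE *.
  (* This is ell without its power of [phi t]; multiplying the goal by it turns the left side into
     k1 ell. *)
  have cancel_factor : p * (D * sl) / N ^+ 2 != 0.
    exact: mulf_neq0 (mulf_neq0 p_neq0 (mulf_neq0 sn sd))
      (invr_neq0 (expf_neq0 2 N0)).
  apply: (mulIf cancel_factor).
  have -> : k1 t * phi t ^+ k.-1 * (p * (D * sl) / N ^+ 2) =
      k1 t * (p * (D * (phi t ^+ k.-1 * sl) / N ^+ 2)) by ring.
  by rewrite kE /q /curvature_ratio -/N -/sl -/D; field; rewrite N0 sn sd.
have comp0 (h : R -> R) : is_derive (0 : R) 1 h 0 -> is_derive t0 1 (h \o phi) 0.
  rewrite -[X in is_derive X]phit0 => dh.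
  by apply: (is_derive_eq (is_derive1_comp dh dphi0)); rewrite mul0r.
(* Truncated subtraction forces two cases. In the second, the factor is built from the inverse of
   [q], and exchanging [k1] and [k2] only changes the sign of the Wronskian. *)
have [kn|/ltnW nlek] := leqP k n.
- have dh : is_derive t0 1 ((fun u => u ^+ (n - k) * q u) \o phi) 0.
    apply/comp0/(is_derive0_powM dq).
    case: nk => [[nk f'0]|kn2|nk2]; [left|right|right]; last 2 first.
    + by lia.
    + by lia.
    + by rewrite nk subnn f'0 mulr0.
  have PIt0 := PI _ It0.
  apply: (wronskian_eq0 dk1 dk2 dh).
  near=> t.
  have [pt kE] : phi t != 0 /\
    k1 t * phi t ^+ k.-1 = k2 t * phi t ^+ n.-1 * q (phi t) by near: t.
  apply: (mulIf (expf_neq0 k.-1 pt)); rewrite kE /=.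
  by rewrite -mulrA -[RHS]mulrA mulrAC -exprD; congr (_ * (_ ^+ _ * _)); lia.
- have dh : is_derive t0 1 ((fun u => u ^+ (k - n) * (q u)^-1) \o phi) 0.
    apply/comp0/(is_derive0_powM dqV).
    case: nk => [[nk f'0]|kn2|nk2]; [left|right|right]; last 2 first.
    + by lia.
    + by lia.
    + by rewrite nk subnn f'0 mulr0 scaler0.
  have PIt0 := PI _ It0.
  have -> : derive_in I k1 t0 * k2 t0 - k1 t0 * derive_in I k2 t0 =
      - (derive_in I k2 t0 * k1 t0 - k2 t0 * derive_in I k1 t0) by ring.
  apply/eqP; rewrite oppr_eq0; apply/eqP; apply: (wronskian_eq0 dk2 dk1 dh).
  near=> t.
  have [pt kE] : phi t != 0 /\
    k1 t * phi t ^+ k.-1 = k2 t * phi t ^+ n.-1 * q (phi t) by near: t.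
  have qt : q (phi t) != 0.
    by near: t; apply: near_within_dnbhs; exact: cvg_within.
  apply: (mulIf (expf_neq0 n.-1 pt)); rewrite /= !mulrA.
  have -> : k1 t * phi t ^+ (k - n) / q (phi t) * phi t ^+ n.-1 =
      k1 t * phi t ^+ k.-1 / q (phi t).
    have -> : k.-1 = ((k - n) + n.-1)%N by lia.
    by rewrite exprD; ring.
  by rewrite kE mulfK.
Unshelve. all: by end_near. Qed.

Unset Implicit Arguments.

Theorem theorem4p9 (R : realType) (I : set R) (gamma nu : R -> R * R)
    (k1 k2 : R -> R)
    (I_interval : is_interval I) (I_closed : closed I)
    (gamma_nu : legendre_curve I gamma nu)
    (k1_smooth : smooth_in I k1) (k2_smooth : smooth_in I k2)
    (k_neq0 : forall t, I t -> (k1 t, k2 t) <> (0, 0))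
    (k_curvature : forall t, I t ->
       k1 t * curvature_ell I nu t + k2 t * curvature_beta I gamma nu t = 0)
    (four_points : at_least 4 (fun t0 : R => exists (n k : nat) (f : R -> R),
       point_of_type I gamma nu t0 n k f /\
       [\/ n = k /\ derive1 f 0 = 0, (k + 2 <= n)%N | (n + 2 <= k)%N])) :
  at_least 4 (vertex I k1 k2).
Proof.
case: four_points => x [x_inj types]; exists x; split=> // i.
have Ix j : I (x j) by have [n [k [f [[]]]]] := types j.
(* Two distinct points make [I] nondegenerate, so that each of its points is an accumulation
   point. *)
have x01 : x ord0 != x ord_max by apply/eqP => /x_inj.
have [n [k [f [nf nk]]]] := types i.
(* Smoothness at order 0 is derivability of the function itself. *)
apply: (point_of_type_vertex _ (k1_smooth 0 _ (Ix i)) (k2_smooth 0 _ (Ix i))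
  k_curvature nf nk).
by move=> t; exact: (interval_within_dnbhs_proper I_interval (Ix _) (Ix _) x01).
Qed.
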